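(* Let $\mathbb{X}$ be a real ordered vector space, $x,y\in\mathbb{X}$ with $x\le y$, let $\mathbb{Y}$ be a Dedekind complete vector lattice, and let $\mathcal{BV}$ be the space of all functions $f:[x,y]\to\mathbb{Y}$ of bounded variation. Put $\mathcal{BV}^+=\{f\in\mathcal{BV}:f([x,y])\subseteq\mathbb{Y}^+\}$ and $\mathcal{BV}_0^+=\{f\in\mathcal{BV}^+: f\text{ is monotonically increasing}\}$. Then: (1) $(\mathcal{BV},\mathcal{BV}_0^+)$ is a real ordered vector space. For $f,g\in\mathcal{BV}$ write $f\le_0 g$ if $g-f\in\mathcal{BV}_0^+$, and define $|\cdot|_{\mathcal V}:\mathcal{BV}\to\mathcal{BV}_0^+$ by $|f|_{\mathcal V}=|f(x)|+\mathcal{V}_f$. Then: (2) $|f|_{\mathcal V}=f$ for every $f\in\mathcal{BV}_0^+$. (3) $|f|_{\mathcal V}\pm f\in\mathcal{BV}_0^+$ for every $f\in\mathcal{BV}$. (4) $|\alpha f|_{\mathcal V}=|\alpha|\,|f|_{\mathcal V}$ for every $f\in\mathcal{BV}$ and $\alpha\in\mathbb{R}$. (5) For $f,g,h\in\mathcal{BV}_0^+$ such that $|f-g|_{\mathcal V}=f+g$ and $g-h\in\mathcal{BV}_0^+$, we have $|f-h|_{\mathcal V}=f+h$. (6) $|f\pm g|_{\mathcal V}\le |f|_{\mathcal V}+|g|_{\mathcal V}$ (pointwise on $[x,y]$) for all $f,g\in\mathcal{BV}$. For $f,g\in\mathcal{BV}$ write $f\dot\vee g:=\frac12(f+g+|f-g|_{\mathcal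 V})$ and $f\dot\wedge g:=-\{(-f)\dot\vee(-g)\}=\frac12(f+g-|f-g|_{\mathcal V})$. Then: (7) $f\dot\wedge g\le_0 f\le_0 f\dot\vee g$ and $f\dot\wedge g\le_0 g\le_0 f\dot\vee g$ for all $f,g\in\mathcal{BV}$.
   Context: A real ordered vector space is a real vector space $\mathbb{V}$ with a cone $\mathbb{V}^+$ (non-empty, closed under addition and under multiplication by non-negative reals); $u\le v$ means $v-u\in\mathbb{V}^+$, and $u<v$ means $u\le v$ and $u\neq v$. For $a\le b$ in $\mathbb{X}$, $[a,b]=\{w\in\mathbb{X}: a\le w\le b\}$. A partition $\mathcal{P}$ of $[a,b]$ is a finite chain $a=x_0<x_1<\cdots<x_{n_{\mathcal P}}=b$ of points of $[a,b]$ (if $a=b$ this is the single point and the sum below is $0$). In a vector lattice $\mathbb{Y}$, $|u|=u\vee(-u)$. $\mathbb{Y}$ is Dedekind complete if every non-empty subset that is bounded above has a supremum in $\mathbb{Y}$. A function $f$ on $[a,b]$ with values in $\mathbb{Y}$ is of bounded variation on $[a,b]$ if $\mathcal{V}(f,a,b)=\sup\{\sum_{i=1}^{n_{\mathcal P}}|f(x_i)-f(x_{i-1})|:\mathcal P \text{ a partition of }[a,b]\}$ exists in $\mathbb{Y}$. If $\mathbb{Y}$ is Dedekind complete and $f\in\mathcal{BV}$, then $f$ is of bounded variation on $[x,z]$ for every $z\in[x,y]$, and the variation function $\mathcal{V}_f:[x,y]\to\mathbb{Y}$ is $\mathcal{V}_f(z)=\mathcal{V}(f,x,z)$. Thus $|f|_{\mathcal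 V}$ is the function $z\mapsto|f(x)|+\mathcal{V}_f(z)$. A function $h:[x,y]\to\mathbb{Y}$ is monotonically increasing if $z_1\le z_2$ in $[x,y]$ implies $h(z_1)\le h(z_2)$. Functions in $\mathcal{BV}$ are added, scaled and (for $\le$) compared pointwise. *)

(* Defs.v *)
From HB Require Import structures.
From mathcomp Require Import all_boot all_order all_algebra.
From mathcomp Require Import boolp classical_sets functions reals.

Set Implicit Arguments.
Unset Strict Implicit.
Unset Printing Implicit Defensive.

Import Order.TTheory GRing.Theory Num.Theory.

Local Open Scope classical_set_scope.
Local Open Scope ring_scope.

(* A cone need not be pointed: it may contain a line. *)
Definition cone (R : realType) (V : lmodType R) (K : set V) : Prop :=
  [/\ K !=set0,
      forall u v, K u -> K v -> K (u + v) &
      forall (a : R) u, 0 <= a -> K u -> K (a *: u)].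

HB.mixin Record Lmodule_isOrderedVect (R : realType) V of GRing.Lmodule R V := {
  poscone : set V;
  poscone_cone : cone poscone
}.

#[short(type="orderedVectType")]
HB.structure Definition OrderedVect (R : realType) :=
  { V of GRing.Lmodule R V & Lmodule_isOrderedVect R V }.

Arguments poscone {R V} : rename.

Definition vle (R : realType) (V : orderedVectType R) (u v : V) : Prop :=
  poscone (v - u).

(* As the cone need not be pointed, [vlt u v] and [vlt v u] may both hold. *)
Definition vlt (R : realType) (V : orderedVectType R) (u v : V) : Prop :=
  vle u v /\ u <> v.

(* An ordered vector space in which the relation [vle] is a partial order,
   shared with that of the library, for which any two elements have a supremum
   and an infimum. *)
HB.mixin Record OrderedVect_isVectorLattice (R : realType) V
    of OrderedVect R V & Num.POrderedZmodule V := {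
  le_vle : forall u v : V, (u <= v) <-> vle u v;
  vjoin : V -> V -> V;
  vmeet : V -> V -> V;
  vjoinP : forall u v : V, supremums [set u; v] (vjoin u v);
  vmeetP : forall u v : V, infimums [set u; v] (vmeet u v)
}.

#[short(type="vectorLatticeType")]
HB.structure Definition VectorLattice (R : realType) :=
  { V of OrderedVect R V & Num.POrderedZmodule V
       & OrderedVect_isVectorLattice R V }.

Definition dedekind_complete (R : realType) (Y : vectorLatticeType R) : Prop :=
  forall A : set Y, has_sup A -> supremums A !=set0.

Definition vabs (R : realType) (Y : vectorLatticeType R) (u : Y) : Y :=
  vjoin u (- u).

Definition segment (R : realType) (X : orderedVectType R) (x y : X) : set X :=
  [set w | vle x w /\ vle w y].

(* [E], with the operations of [V] and the cone [K], is an ordered vector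
   space. *)
Definition ordered_subspace (R : realType) (V : lmodType R) (E K : set V) :
    Prop :=
  [/\ GRing.submod_closed [in E], K `<=` E & cone K].

Section variation.
Context {R : realType} {X : orderedVectType R} {x y : X}
  {Y : vectorLatticeType R}.
Implicit Types (f g : segment x y -> Y) (a b z : segment x y)
  (s : seq (segment x y)).

(* The chain is [a :: s]; its points automatically lie in [segment a b].  The
   chain of length 0 occurs exactly when [a = b], and it is then the only one
   if the cone of [X] is pointed. *)
Definition partition a b s : Prop :=
  path (fun u v => `[< vlt (val u) (val v) >]) a s /\ last a s = b.

Definition variation a b f s : Y :=
  let F := f \o nth b (a :: s) in
  \sum_(0 <= i < size s) vabs (F i.+1 - F i).

Definition variations a b f : set Y :=
  [set variation a b f s | s in partition a b].

Definition bounded_variation a b f : Prop :=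
  supremums (variations a b f) !=set0.

(* [supremum] takes the default value 0 if the supremum does not exist; this
   does not happen in [variation_function] below on [BV], see
   [variation_functionP]. *)
Definition total_variation a b f : Y := supremum 0 (variations a b f).

Definition increasing f : Prop :=
  forall z1 z2, vle (val z1) (val z2) -> f z1 <= f z2.

End variation.

Lemma vle_refl (R : realType) (X : orderedVectType R) (u : X) : vle u u.
Proof.
rewrite /vle subrr; have [[v Kv] _ KZ] := @poscone_cone R X.
by rewrite -(scale0r v); apply: KZ.
Qed.

Section bounded_variation_space.
Context {R : realType} {X : orderedVectType R} {x y : X} (hxy : vle x y)
  {Y : vectorLatticeType R}.
Implicit Types f g : segment x y -> Y.

Definition lend : segment x y :=
  exist _ x (mem_set (conj (vle_refl x) hxy)).

Definition rend : segment x y :=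
  exist _ y (mem_set (conj hxy (vle_refl y))).

Definition BV : set (segment x y -> Y) :=
  [set f | bounded_variation lend rend f].

Definition BVpos : set (segment x y -> Y) :=
  [set f | BV f /\ range f `<=` poscone].

Definition BV0pos : set (segment x y -> Y) :=
  [set f | BVpos f /\ increasing f].

Definition le0 f g : Prop := BV0pos (g - f).

Definition variation_function f : segment x y -> Y :=
  fun z => total_variation lend z f.

Definition absV f : segment x y -> Y :=
  fun z => vabs (f lend) + variation_function f z.

Definition dotvee f g : segment x y -> Y :=
  2^-1 *: (f + g + absV (f - g)).

Definition dotwedge f g : segment x y -> Y := - dotvee (- f) (- g).

End bounded_variation_space.

Section variation_function_exists.
Context {R : realType} {X : orderedVectType R} {x y : X} (hxy : vle x y)
  {Y : vectorLatticeType R}.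

Lemma le_subr0 (u v : Y) : (u <= v) <-> (0 <= v - u).
Proof. by rewrite !le_vle /vle subr0. Qed.

Lemma add_ge0 (u v : Y) : 0 <= u -> 0 <= v -> 0 <= u + v.
Proof.
rewrite !le_vle /vle !subr0; have [_ + _] := @poscone_cone R Y; exact.
Qed.

Lemma vabs_ge0 (u : Y) : 0 <= vabs u.
Proof.
have [ub _] := vjoinP u (- u).
have /le_subr0 h1 : u <= vabs u by apply: ub; left.
have /le_subr0 h2 : - u <= vabs u by apply: ub; right.
have h : 0 <= 2 *: vabs u.
  rewrite scalerDl scale1r.
  by have := add_ge0 h1 h2; rewrite opprK addrACA addNr addr0.
move: h; rewrite !le_vle /vle !subr0 => h.
have [_ _ KZ] := @poscone_cone R Y.
have := KZ 2^-1 _ _ h; rewrite scalerA mulVf ?pnatr_eq0// scale1r; apply.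
by rewrite invr_ge0 ler0n.
Qed.

Lemma variation_rcons (a b c : segment x y) (f : segment x y -> Y) s :
  last a s = b ->
  variation a c f (rcons s c) = variation a b f s + vabs (f c - f b).
Proof.
move=> hb; rewrite /variation size_rcons big_nat_recr//=; congr (_ + _); last first.
  rewrite nth_rcons ltnn eqxx -hb -rcons_cons nth_rcons/= ltnS leqnn.
  by rewrite -last_nth; congr (vabs (_ - f _)); exact: set_nth_default.
rewrite !big_nat; apply: eq_bigr => i /= hi.
rewrite -rcons_cons !nth_rcons/= ltnS hi (ltnW hi).
by congr (vabs (f _ - f _)); apply: set_nth_default => /=; rewrite ?ltnS ?hi ?(ltnW hi).
Qed.

Lemma variation_functionP (f : segment x y -> Y) (z : segment x y) :
  dedekind_complete Y -> BV hxy f ->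
  supremums (variations (lend hxy) z f) (variation_function hxy f z).
Proof.
move=> hY [V [Vub _]].
have hs : has_sup (variations (lend hxy) z f).
  split.
    have [->|/eqP zx] := eqVneq z (lend hxy).
      by exists (variation (lend hxy) (lend hxy) f [::]), [::].
    exists (variation (lend hxy) z f [:: z]), [:: z] => //; split => //=.
    rewrite andbT; apply/asboolP; split; first by have /set_mem[] := valP z.
    by move=> e; apply: zx; apply: val_inj.
  exists V => _ [s [ps ls] <-].
  have [zy|/eqP zy] := eqVneq z (rend hxy).
    by apply: Vub; rewrite -?zy; exists s => //; split; rewrite -?zy.
  have : variation (lend hxy) (rend hxy) f (rcons s (rend hxy)) <= V.
    apply: Vub; exists (rcons s (rend hxy)) => //; split.
      rewrite rcons_path ps ls; apply/asboolP; split.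
        by have /set_mem[] := valP z.
      by move=> e; apply: zy; apply: val_inj.
    by rewrite last_rcons.
  apply: le_trans; rewrite (variation_rcons _ _ ls).
  by apply/le_subr0; rewrite addrAC subrr add0r vabs_ge0.
have sn := hY _ hs.
rewrite /variation_function /total_variation /supremum ifF.
  by case: sn => v hv; apply: (@xgetPex _ 0 (supremums _)); exists v.
by apply/negP => /eqP e; case: hs => -[w]; rewrite e.
Qed.
End variation_function_exists.

(* Main.v *)
Require Import Defs.
From HB Require Import structures.
From mathcomp Require Import all_boot all_order all_algebra.
From mathcomp Require Import boolp classical_sets functions reals.

Set Implicit Arguments.
Unset Strict Implicit.
Unset Printing Implicit Defensive.

Import Order.TTheory GRing.Theory Num.Theory.

Local Open Scope classical_set_scope.
Local Open Scope ring_scope.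

(** The map [absV] is the value at the left end plus the variation function, so
    everything rests on three facts about the sum of [vabs (f x_i - f x_(i-1))]
    over a chain.

    As a function of [f] that sum is subadditive and absolutely homogeneous
    ([variationD], [variationZ]), because [vabs] is.  Suprema over all chains
    inherit both properties, and Dedekind completeness turns an upper bound into
    a supremum ([BV_bounded]); hence [BV] is a subspace, [absV] is absolutely
    homogeneous ([absVZ]) and it satisfies the triangle inequality ([absVD_le]).

    For increasing [f] the sum telescopes to [f z - f x] whatever the chain is
    ([variation_increasing]).  So nonnegative increasing functions have bounded
    variation and are fixed by [absV] ([absV_id]).

    Adding one more point [z2] to a chain that ends at [z1] adds
    [vabs (f z2 - f z1)] to its sum, so that the variation function grows from
    [z1] to [z2] at least by that amount ([variation_function_step]).  As
    [vabs (f z2 - f z1)] dominates both [f z2 - f z1] and its opposite, the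
    functions [absV f + f] and [absV f - f] are increasing ([absVD_BV0pos]), and
    so is their half sum [absV f].

    The remaining claims are formal.  If [absV (f - g) = f + g] and [g - h] is
    nonnegative increasing, then
    [f + g <= absV (f - h) + absV (g - h) = absV (f - h) + g - h]
    gives [f + h <= absV (f - h)], and the triangle inequality gives the
    converse.  The differences compared in the last claim are the halves of
    [absV (f - g) + (f - g)] and [absV (f - g) - (f - g)]. *)

Local Notation partition := Defs.partition.

(** * Halves in a module *)

Section halves.
Context {R : realType} {V : lmodType R}.
Implicit Types u v w : V.

Lemma half_double u : 2^-1 *: (u + u) = u :> V.
Proof. by rewrite -mulr2n -scaler_nat scalerA mulVf ?scale1r// pnatr_eq0. Qed.

Lemma half_subl u v w : 2^-1 *: (u + v + w) - u = 2^-1 *: (w - (u - v)).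
Proof.
rewrite -[X in _ - X]half_double -scalerBr opprB.
rewrite [u + v + w]addrC -addrA; congr (_ *: (_ + _)).
by rewrite [u + v]addrC opprD addrA addrK.
Qed.

End halves.

(** * Order and absolute value in a vector lattice *)

Section vector_lattice.
Context {R : realType} {Y : vectorLatticeType R}.
Implicit Types u v w : Y.

Lemma ge0_poscone u : 0 <= u <-> poscone u.
Proof. by rewrite le_vle /vle subr0. Qed.

Lemma leD u v u' v' : u <= v -> u' <= v' -> u + u' <= v + v'.
Proof.
move=> /le_subr0 h /le_subr0 h'; apply/le_subr0.
by rewrite opprD addrACA; apply: add_ge0.
Qed.

Lemma leBrD u v w : u <= v - w <-> u + w <= v.
Proof.
have e : v - (u + w) = v - w - u by rewrite opprD [- u - w]addrC addrA.
by split=> /le_subr0 h; apply/le_subr0; move: h; rewrite e.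
Qed.

Lemma scale_ge0 (a : R) u : 0 <= a -> 0 <= u -> 0 <= a *: u.
Proof.
by move=> a0 /ge0_poscone u0; apply/ge0_poscone; have [_ _] := @poscone_cone R Y; apply.
Qed.

Lemma leZ (a : R) u v : 0 <= a -> u <= v -> a *: u <= a *: v.
Proof.
by move=> a0 /le_subr0 h; apply/le_subr0; rewrite -scalerBr; apply: scale_ge0.
Qed.

Lemma leN u v : u <= v -> - v <= - u.
Proof. by move=> /le_subr0 h; apply/le_subr0; rewrite opprK addrC. Qed.

Lemma le_vabs u : u <= vabs u.
Proof. by have [ub _] := vjoinP u (- u); apply: ub; left. Qed.

Lemma leN_vabs u : - u <= vabs u.
Proof. by have [ub _] := vjoinP u (- u); apply: ub; right. Qed.

Lemma vabs_le u w : u <= w -> - u <= w -> vabs u <= w.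
Proof. by move=> h h'; have [_] := vjoinP u (- u); apply=> _ [->|->]. Qed.

Lemma ge0_vabs u : 0 <= u -> vabs u = u.
Proof.
move=> u0; apply/le_anti/andP; split; last exact: le_vabs.
by apply: vabs_le => //; apply: (le_trans _ u0); rewrite -[leRHS]oppr0; apply: leN.
Qed.

Lemma vabsD u v : vabs (u + v) <= vabs u + vabs v.
Proof.
apply: vabs_le; first by apply: leD; apply: le_vabs.
by rewrite opprD; apply: leD; apply: leN_vabs.
Qed.

Lemma vabsZ_le (a : R) u : vabs (a *: u) <= `|a| *: vabs u.
Proof.
have le b : b *: u <= `|b| *: vabs u.
  have [b0|b0] := leP 0 b.
    by rewrite ger0_norm//; apply: leZ => //; apply: le_vabs.
  rewrite ltr0_norm// -[b in leLHS]opprK scaleNr -scalerN.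
  by apply: (leZ _ (leN_vabs u)); rewrite oppr_ge0 ltW.
apply: vabs_le; first exact: le.
by rewrite -scaleNr -(normrN a); apply: le.
Qed.

(** For [a != 0], [vabsZ_le] applied to the scalar [a^-1] and the vector
    [a *: u] is the reverse inequality. *)
Lemma vabsZ (a : R) u : vabs (a *: u) = `|a| *: vabs u.
Proof.
apply/le_anti/andP; split; first exact: vabsZ_le.
have [->|a0] := eqVneq a 0; first by rewrite normr0 scale0r vabs_ge0.
have := vabsZ_le a^-1 (a *: u); rewrite scalerA mulVf// scale1r => h.
have := leZ (normr_ge0 a) h.
by rewrite scalerA -normrM mulfV// normr1 scale1r.
Qed.

End vector_lattice.

(** * Variation along a chain *)

Section chains.
Context {R : realType} {X : orderedVectType R} {x y : X}
  {Y : vectorLatticeType R}.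
Implicit Types (f g : segment x y -> Y) (a b c : segment x y)
  (s : seq (segment x y)).

Lemma variation_nil a b f : variation a b f [::] = 0.
Proof. by rewrite /variation big_geq. Qed.

Lemma variation_cons a b c f s :
  variation a b f (c :: s) = vabs (f c - f a) + variation c b f s.
Proof. by rewrite /variation /= big_nat_recl. Qed.

Lemma variationD a b f g s :
  variation a b (f + g) s <= variation a b f s + variation a b g s.
Proof.
elim: s a => [|c s ih] a; first by rewrite !variation_nil addr0.
rewrite !variation_cons addrACA; apply: leD => //.
by rewrite !fctE opprD addrACA; apply: vabsD.
Qed.

Lemma variationZ (k : R) a b f s :
  variation a b (k *: f) s = `|k| *: variation a b f s.
Proof.
elim: s a => [|c s ih] a; first by rewrite !variation_nil scaler0.
by rewrite !variation_cons ih scalerDr -vabsZ scalerBr.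
Qed.

Lemma variation_increasing a b f s :
  increasing f -> partition a b s -> variation a b f s = f b - f a.
Proof.
move=> fi; elim: s a => [|c s ih] a [] /=.
  by move=> _ <-; rewrite variation_nil subrr.
move=> /andP[/asboolP[ac _] ps] ls.
rewrite variation_cons ih// ge0_vabs; first by rewrite addrC addrA subrK.
by apply: (le_subr0 _ _).1; apply: fi.
Qed.

Lemma partition_rcons a b c s :
  partition a b s -> vlt (val b) (val c) -> partition a c (rcons s c).
Proof.
move=> [ps ls] bc; split; last by rewrite last_rcons.
by rewrite rcons_path ps ls; apply/asboolP.
Qed.

Lemma exists_partition a b : vle (val a) (val b) -> exists s, partition a b s.
Proof.
have [<-|/eqP ab] := eqVneq a b; first by exists [::].
move=> le_ab; exists (rcons [::] b); apply: (@partition_rcons _ a) => //.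
by split=> // /val_inj.
Qed.

End chains.

(** * Variation functions and the space of functions of bounded variation *)

Section variation_space.
Context {R : realType} {X : orderedVectType R} {x y : X} (hxy : vle x y)
  {Y : vectorLatticeType R} (hY : dedekind_complete Y).
Implicit Types (f g : segment x y -> Y) (z : segment x y).

Local Notation lend := (lend hxy).
Local Notation rend := (rend hxy).
Local Notation BV := (@BV _ _ _ _ hxy Y).
Local Notation BV0pos := (@BV0pos _ _ _ _ hxy Y).
Local Notation variation_function := (@variation_function _ _ _ _ hxy Y).
Local Notation absV := (@absV _ _ _ _ hxy Y).

Lemma lend_le z : vle (val lend) (val z).
Proof. by have /set_mem[] := valP z. Qed.

(** The set of variations is nonempty, because the two ends are joined by a chain
    with at most one step; in a Dedekind complete lattice any upper bound of it
    then gives a supremum. *)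
Lemma BV_bounded f M :
  (forall s, partition lend rend s -> variation lend rend f s <= M) -> BV f.
Proof.
move=> hM; apply: hY; split; last by exists M => _ [s ps <-]; apply: hM.
have [s ps] := exists_partition (lend_le rend).
by exists (variation lend rend f s), s.
Qed.

Lemma variation_le_function f z s :
  BV f -> partition lend z s -> variation lend z f s <= variation_function f z.
Proof.
by move=> bf ps; have [ub _] := variation_functionP z hY bf; apply: ub; exists s.
Qed.

Lemma variation_function_le f z M : BV f ->
  (forall s, partition lend z s -> variation lend z f s <= M) ->
  variation_function f z <= M.
Proof.
move=> bf hM; have [_] := variation_functionP z hY bf; apply.
by move=> _ [s ps <-]; apply: hM.
Qed.

(** A chain from the left end to [z1] extends by the single step to [z2], which
    adds [vabs (f z2 - f z1)] to its variation; take the supremum over the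
    chains that end at [z1].  Consecutive points of a chain differ, whence the
    separate case [z1 = z2]. *)
Lemma variation_function_step f z1 z2 : BV f -> vle (val z1) (val z2) ->
  variation_function f z1 + vabs (f z2 - f z1) <= variation_function f z2.
Proof.
move=> bf z12; have [<-|/eqP ne] := eqVneq z1 z2.
  by rewrite subrr ge0_vabs// addr0.
apply/leBrD/variation_function_le => // s ps; apply/leBrD.
have [_ ls] := ps; rewrite -(variation_rcons z2 f ls).
apply: variation_le_function => //; apply: partition_rcons ps _.
by split=> // /val_inj.
Qed.

Lemma vabs_le_function f z : BV f ->
  vabs (f z - f lend) <= variation_function f z.
Proof.
move=> bf; apply: le_trans (variation_function_step bf (lend_le z)).
apply/le_subr0; rewrite addrK.
rewrite -(variation_nil lend lend f); apply: variation_le_function => //.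
Qed.

Lemma BVD f g : BV f -> BV g -> BV (f + g).
Proof.
move=> bf bg.
apply: (@BV_bounded _ (variation_function f rend + variation_function g rend)).
move=> s ps; apply: le_trans (variationD _ _ _ _ _) _.
by apply: leD; apply: variation_le_function.
Qed.

Lemma BVZ (k : R) f : BV f -> BV (k *: f).
Proof.
move=> bf; apply: (@BV_bounded _ (`|k| *: variation_function f rend)) => s ps.
by rewrite variationZ; apply: leZ => //; apply: variation_le_function.
Qed.

Lemma BVN f : BV f -> BV (- f).
Proof. by move=> bf; rewrite -scaleN1r; apply: BVZ. Qed.

Lemma BVB f g : BV f -> BV g -> BV (f - g).
Proof. by move=> bf bg; apply/BVD/BVN. Qed.

Lemma increasing_BV f : increasing f -> BV f.
Proof.
move=> fi; apply: (@BV_bounded _ (f rend - f lend)) => s ps.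
by rewrite variation_increasing.
Qed.

(** Bounded variation comes for free, and an increasing function is nonnegative
    as soon as it is so at the left end. *)
Lemma BV0posP f : BV0pos f <-> 0 <= f lend /\ increasing f.
Proof.
split=> [[[_ f0] fi]|[f0 fi]].
  by split=> //; apply/ge0_poscone/f0; exists lend.
split=> //; split; first exact: increasing_BV.
move=> _ [z _ <-]; apply/ge0_poscone/(le_trans f0).
by apply: fi; apply: lend_le.
Qed.

Lemma BV0pos_BV f : BV0pos f -> BV f.
Proof. by case=> -[]. Qed.

Lemma BV0posD f g : BV0pos f -> BV0pos g -> BV0pos (f + g).
Proof.
move=> /BV0posP[f0 fi] /BV0posP[g0 gi]; apply/BV0posP; split; first exact: add_ge0.
by move=> z1 z2 z12; apply: leD; [apply: fi | apply: gi].
Qed.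

Lemma BV0posZ (k : R) f : 0 <= k -> BV0pos f -> BV0pos (k *: f).
Proof.
move=> k0 /BV0posP[f0 fi]; apply/BV0posP; split; first exact: scale_ge0.
by move=> z1 z2 z12; apply: leZ => //; apply: fi.
Qed.

Lemma zero_BV0pos : BV0pos 0.
Proof. by apply/BV0posP; split. Qed.

Lemma BV_ordered_subspace : ordered_subspace BV BV0pos.
Proof.
split; last split.
- split; first by apply/mem_set/BV0pos_BV/zero_BV0pos.
  by move=> k f g /set_mem bf /set_mem bg; apply/mem_set/BVD => //; apply: BVZ.
- by move=> f; apply: BV0pos_BV.
- by exists 0; apply: zero_BV0pos.
- exact: BV0posD.
- exact: BV0posZ.
Qed.

(** * The generalized absolute value *)

Lemma absV_id f : BV0pos f -> absV f = f.
Proof.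
move=> f0p; have [f0 fi] := (BV0posP f).1 f0p; apply/funext => z.
have bf := BV0pos_BV f0p.
suff e : variation_function f z = f z - f lend.
  by rewrite /absV e ge0_vabs// addrC subrK.
apply/le_anti/andP; split.
  by apply: variation_function_le => // s ps; rewrite variation_increasing.
by apply: le_trans (le_vabs _) _; apply: vabs_le_function.
Qed.

Lemma absVD_le f g z : BV f -> BV g -> absV (f + g) z <= absV f z + absV g z.
Proof.
move=> bf bg; rewrite /absV addrACA; apply: leD; first exact: vabsD.
apply: variation_function_le; first exact: BVD.
move=> s ps; apply: le_trans (variationD _ _ _ _ _) _.
by apply: leD; apply: variation_le_function.
Qed.

(** As for [vabsZ], the inequality for [k^-1] and [k *: f] is the reverse one, so
    that only one direction needs a supremum argument. *)
Lemma absVZ (k : R) f : BV f -> absV (k *: f) = `|k| *: absV f.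
Proof.
have le j g z : BV g -> absV (j *: g) z <= `|j| *: absV g z.
  move=> bg; rewrite /absV scalerDr; apply: leD; first exact: vabsZ_le.
  apply: variation_function_le; first exact: BVZ.
  by move=> s ps; rewrite variationZ; apply: leZ => //; apply: variation_le_function.
move=> bf; have [->|k0] := eqVneq k 0.
  by rewrite normr0 !scale0r; apply/absV_id/zero_BV0pos.
apply/funext => z; apply/le_anti/andP; split; first exact: le.
have := leZ (normr_ge0 k) (le k^-1 (k *: f) z (BVZ k bf)).
by rewrite !scalerA -normrM mulVf// mulfV// normr1 !scale1r.
Qed.

Lemma absVN f : BV f -> absV (- f) = absV f.
Proof. by move=> bf; rewrite -scaleN1r absVZ// normrN1 scale1r. Qed.

Lemma absVB_le f g z : BV f -> BV g -> absV (f - g) z <= absV f z + absV g z.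
Proof. by move=> bf bg; rewrite -(absVN bg); apply: absVD_le => //; apply: BVN. Qed.

(** Monotonicity is [variation_function_step] together with
    [- (f z2 - f z1) <= vabs (f z2 - f z1)].  The sign only has to be checked at
    the left end, where [- f x <= vabs (f x)]. *)
Lemma absVD_BV0pos f : BV f -> BV0pos (absV f + f).
Proof.
move=> bf; apply/BV0posP; split.
  (* If the cone of X contains a line, chains from the left end to itself may
     be loops of positive length; the sign of the supremum is enough here. *)
  have := vabs_le_function lend bf; rewrite subrr ge0_vabs// => V0.
  rewrite !fctE /absV addrAC; apply: add_ge0 => //.
  by have /le_subr0 := leN_vabs (f lend); rewrite opprK.
move=> z1 z2 z12; rewrite !fctE /absV -!addrA; apply: leD => //.
have := le_trans (leD (lexx _) (leN_vabs _)) (variation_function_step bf z12).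
by move=> /leD/(_ (lexx (f z2))); rewrite opprB addrA subrK.
Qed.

Lemma absVB_BV0pos f : BV f -> BV0pos (absV f - f).
Proof. by move=> bf; rewrite -(absVN bf); apply/absVD_BV0pos/BVN. Qed.

Lemma absV_BV0pos f : BV f -> BV0pos (absV f).
Proof.
move=> bf; have -> : absV f = 2^-1 *: (absV f + f + (absV f - f)).
  by rewrite addrACA subrr addr0 half_double.
apply: BV0posZ; first by rewrite invr_ge0.
by apply: BV0posD; [apply: absVD_BV0pos | apply: absVB_BV0pos].
Qed.

(** The lower bound is the triangle inequality for [f - g = (f - h) - (g - h)],
    where [absV] fixes [g - h]; the upper bound holds for all [f] and [h] in
    [BV0pos]. *)
Lemma absVB_disjoint_le f g h : BV0pos f -> BV0pos g -> BV0pos h ->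
  absV (f - g) = f + g -> BV0pos (g - h) -> absV (f - h) = f + h.
Proof.
move=> pf pg ph e pgh; have [bf bh] := (BV0pos_BV pf, BV0pos_BV ph).
apply/funext => z; apply/le_anti/andP; split.
  by have := absVB_le z bf bh; rewrite (absV_id pf) (absV_id ph).
have := absVB_le z (BVB bf bh) (BV0pos_BV pgh).
rewrite opprB addrA subrK e (absV_id pgh) !fctE.
move=> /leD/(_ (lexx (h z - g z))).
by rewrite addrACA subrr addr0 -addrA -[h z - g z]opprB subrr addr0.
Qed.

Lemma dotwedgeE f g : BV f -> BV g ->
  dotwedge hxy f g = 2^-1 *: (f + g - absV (f - g)).
Proof.
move=> bf bg; rewrite /dotwedge /dotvee -!opprD (absVN (BVB bf bg)) -scalerN.
by congr (_ *: _); rewrite [LHS]opprD opprK.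
Qed.

(** [f - dotwedge f g] is half of [absV (f - g) + (f - g)], and [g - dotwedge f g]
    is half of [absV (f - g) - (f - g)]. *)
Lemma dotwedge_le0 f g : BV f -> BV g ->
  le0 hxy (dotwedge hxy f g) f /\ le0 hxy (dotwedge hxy f g) g.
Proof.
move=> bf bg; have bfg := BVB bf bg; rewrite dotwedgeE// /le0; split.
  rewrite -opprB half_subl -scalerN opprD opprK opprK.
  by apply: BV0posZ; [rewrite invr_ge0 | apply: absVD_BV0pos].
rewrite [f + g]addrC -opprB half_subl -scalerN opprD opprK opprK -[g - f]opprB.
by apply: BV0posZ; [rewrite invr_ge0 | apply: absVB_BV0pos].
Qed.

Lemma le0_dotvee f g : BV f -> BV g ->
  le0 hxy f (dotvee hxy f g) /\ le0 hxy g (dotvee hxy f g).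
Proof.
move=> bf bg; have bfg := BVB bf bg; rewrite /le0 /dotvee; split.
  rewrite half_subl.
  by apply: BV0posZ; [rewrite invr_ge0 | apply: absVB_BV0pos].
rewrite [f + g]addrC half_subl opprB.
by apply: BV0posZ; [rewrite invr_ge0 | apply: absVD_BV0pos].
Qed.

End variation_space.

Theorem theorem4p6 (R : realType) (X : orderedVectType R) (x y : X)
    (hxy : vle x y) (Y : vectorLatticeType R) (hY : dedekind_complete Y) :
  let BV := BV hxy (Y := Y) in
  let BV0pos := BV0pos hxy (Y := Y) in
  let le0 := le0 hxy (Y := Y) in
  let absV := absV hxy (Y := Y) in
  let dotvee := dotvee hxy (Y := Y) in
  let dotwedge := dotwedge hxy (Y := Y) in
  (* (1) *)
  ordered_subspace BV BV0pos /\
  (* the map |.|_V takes its values in BV0pos *)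
  (forall f, BV f -> BV0pos (absV f)) /\
  (* (2) *)
  (forall f, BV0pos f -> absV f = f) /\
  (* (3) *)
  (forall f, BV f -> BV0pos (absV f + f) /\ BV0pos (absV f - f)) /\
  (* (4) *)
  (forall f (alpha : R), BV f -> absV (alpha *: f) = `|alpha| *: absV f) /\
  (* (5) *)
  (forall f g h, BV0pos f -> BV0pos g -> BV0pos h ->
     absV (f - g) = f + g -> BV0pos (g - h) -> absV (f - h) = f + h) /\
  (* (6) *)
  (forall f g, BV f -> BV g -> forall z,
     absV (f + g) z <= absV f z + absV g z /\
     absV (f - g) z <= absV f z + absV g z) /\
  (* the two expressions for the dotted meet agree *)
  (forall f g, BV f -> BV g ->
     dotwedge f g = 2^-1 *: (f + g - absV (f - g))) /\
  (* (7) *)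
  (forall f g, BV f -> BV g ->
     [/\ le0 (dotwedge f g) f, le0 f (dotvee f g),
         le0 (dotwedge f g) g & le0 g (dotvee f g)]).
Proof.
move=> /=; split; first exact: BV_ordered_subspace.
split; first exact: absV_BV0pos.
split; first exact: absV_id.
split; first by move=> f bf; split; [exact: absVD_BV0pos | exact: absVB_BV0pos].
split; first by move=> f alpha; apply: absVZ.
split; first exact: absVB_disjoint_le.
split; first by move=> f g bf bg z; split; [exact: absVD_le | exact: absVB_le].
split; first exact: dotwedgeE.
move=> f g bf bg.
by have [] := dotwedge_le0 hY bf bg; have [] := le0_dotvee hY bf bg.
Qed.
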